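(* Let $G$ be a graph of order $n$ and size $m$. Then, for $\alpha\in[0,1)$, $$E(A_\alpha(G))\le\sqrt{\frac yn}+\sqrt{(n-1)\left(y-\frac yn\right)},$$ where $y=\alpha^2M_1+(1-\alpha)^2\,2m-\frac{4\alpha^2m^2}{n}$, and equality holds if and only if $G\cong K_2$ or $G\cong\frac n2K_2$.
   Context: Graphs are finite and simple. For a graph $G$ with vertex degrees $d_1,\dots,d_n$ and $m$ edges, adjacency matrix $A(G)$ and diagonal degree matrix $D(G)$, $A_\alpha(G)=\alpha D(G)+(1-\alpha)A(G)$ with eigenvalues $p_1,\dots,p_n$. The $A_\alpha$-energy is $E(A_\alpha(G))=\sum_{i=1}^n\left|p_i-\frac{2\alpha m}{n}\right|$. The Zagreb index is $M_1=\sum_{i=1}^n d_i^2$. $\frac n2K_2$ denotes the disjoint union of $\frac n2$ copies of $K_2$.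
   Formalization: The equality characterization is stated only for graphs with at least one edge: for an edgeless graph both sides of the inequality are 0, so equality holds although G is neither K_2 nor (n/2)K_2. *)

(* Defs.v *)
From mathcomp Require Import all_boot all_order all_algebra.
From mathcomp Require Import polyrcf complex.

Set Implicit Arguments.
Unset Strict Implicit.
Unset Printing Implicit Defensive.

Import Order.TTheory GRing.Theory Num.Theory.
Local Open Scope ring_scope.

(* A graph on a finite vertex type is given by its adjacency relation, assumed
   symmetric and irreflexive. *)
Section Graphs.
Variables (T : finType) (e : rel T).

Definition edges : {set {set T}} := [set [set u.1; u.2] | u : T * T & e u.1 u.2].
Definition gsize : nat := #|edges|.
Definition deg (x : T) : nat := #|[set y | e x y]|.
Definition zagreb1 : nat := (\sum_(x : T) deg x ^ 2)%N.

End Graphs.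

Definition giso (T1 T2 : finType) (e1 : rel T1) (e2 : rel T2) : Prop :=
  exists2 f : T1 -> T2, bijective f & forall x y, e2 (f x) (f y) = e1 x y.

Definition complete_graph (n : nat) : rel 'I_n := [rel x y | x != y].
Arguments complete_graph : clear implicits.

(* The disjoint union of k copies of e; the first component of a vertex is the
   index of the copy containing it. *)
Definition copies (k : nat) (T : finType) (e : rel T) : rel ('I_k * T) :=
  [rel u v | (u.1 == v.1) && e u.2 v.2].
Arguments copies k {T} e : rename.

Section Energy.
Variable R : rcfType.

(* The eigenvalues of A lying in R, repeated according to their algebraic
   multiplicity; spectrum_prod below shows that this is the whole spectrum when
   A is symmetric. *)
Definition spectrum (n : nat) (A : 'M[R]_n) : seq R :=
  flatten [seq nseq (mup x (char_poly A)) x | x <- rootsR (char_poly A)].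

Lemma char_poly_sym_split (n : nat) (A : 'M[R]_n) : A^T = A ->
  exists s : seq R, char_poly A = \prod_(x <- s) ('X - x%:P).
Proof.
move=> symA; pose Ac := map_mx (real_complex R) A.
have Ah : Ac \is hermsymmx.
  apply: realsym_hermsym.
    by apply/is_hermitianmxP; rewrite ?expr0 scale1r map_mx_id // map_trmx symA.
  by apply/mxOverP => i j; rewrite mxE complex_real.
have /mxOverP dR := hermitian_spectral_diag_real Ah.
have /orthomx_spectralP := hermitian_normalmx Ah.
set P := spectralmx Ac; set d := spectral_diag Ac => EA.
have uP : P \in unitmx by exact: spectral_unit.
have cE : char_poly Ac = \prod_(i < n) ('X - (d 0 i)%:P).
  have -> : char_poly Ac = char_poly (diag_mx d).
    rewrite /char_poly; pose Q := map_mx polyC P; pose Q' := map_mx polyC (invmx P).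
    have Q'Q : Q' *m Q = 1%:M by rewrite -map_mxM mulVmx // map_mx1.
    have -> : char_poly_mx Ac = Q' *m char_poly_mx (diag_mx d) *m Q.
      rewrite /char_poly_mx mulmxBr mulmxBl scalar_mxC -(mulmxA _ Q' Q) Q'Q mulmx1.
      by rewrite {1}EA !map_mxM.
    by rewrite !det_mulmx mulrAC -det_mulmx Q'Q det1 mul1r.
  rewrite char_poly_trig ?diag_mx_is_trig //.
  by apply: eq_bigr => i _; rewrite mxE eqxx mulr1n.
exists [seq complex.Re (d 0 i) | i <- enum 'I_n].
apply: (@map_poly_inj _ _ (real_complex R)).
rewrite map_char_poly -/Ac cE rmorph_prod big_map big_enum /=.
by apply: eq_bigr => i _; rewrite rmorphB /= map_polyX map_polyC /= RRe_real.
Qed.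

Lemma spectrum_prod (n : nat) (A : 'M[R]_n) : A^T = A ->
  char_poly A = \prod_(x <- spectrum A) ('X - x%:P).
Proof.
move=> /char_poly_sym_split [s Es]; rewrite {1}Es; apply: perm_big.
rewrite perm_sym; apply/allP => x _ /=; apply/eqP.
rewrite -(mu_prod_XsubC x s) -Es /spectrum.
have p0 : char_poly A != 0 by rewrite monic_neq0 ?char_poly_monic.
set p := char_poly A in p0 *.
have rP y : (y \in rootsR p) = root p y.
  by have := roots_on_rootsR p0 y; rewrite inE /= => <-.
have Cn k (y z : R) : count_mem z (nseq k y) = ((y == z) * k)%N.
  by rewrite count_nseq.
rewrite count_flatten -map_comp (eq_map (g := fun y => ((y == x) * mup y p)%N)).
  rewrite sumnE big_map; case: (boolP (root p x)) => [rx|Nrx].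
    rewrite (bigD1_seq x) ?rP ?uniq_roots //= eqxx mul1n big1 ?addn0 // => y /negPf ->.
    by rewrite mul0n.
  rewrite mupNroot // big_seq big1 // => y; rewrite rP => ry.
  by case: eqP ry Nrx => [-> ->|]//=.
by move=> y /=; rewrite Cn.
Qed.

Variables (n : nat) (e : rel 'I_n).

Definition adj_mx : 'M[R]_n := \matrix_(i, j) (e i j)%:R.
Definition deg_mx : 'M[R]_n := diag_mx (\row_i (deg e i)%:R).

Definition Aalpha (alpha : R) : 'M[R]_n :=
  alpha *: deg_mx + (1 - alpha) *: adj_mx.

Definition energy (alpha : R) : R :=
  \sum_(p <- spectrum (Aalpha alpha))
    `|p - 2%:R * alpha * (gsize e)%:R / n%:R|.

End Energy.

(* Main.v *)
(* With mu = 2 alpha m / n and Q = A_alpha - mu I, the trace of Q^2 is y and the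
   bound B equals sqrt (n y), so the inequality is Cauchy-Schwarz for the
   |p_i - mu|. Equality means that they all coincide, i.e. that Q^2 is a scalar
   matrix. The off-diagonal entries of Q^2 at nonadjacent pairs then show that
   adjacency is transitive; the entry at an edge xy, with x of maximal degree D,
   gives alpha (D + deg y) + (1 - alpha) (D - 1) = 2 mu <= 2 alpha D with
   deg y >= D, whence D = 1, and the diagonal entries exclude isolated
   vertices. Conversely, for a perfect matching Q = (1 - alpha) A is a multiple
   of an involution. *)
Require Import Defs.
From mathcomp Require Import all_boot all_order all_algebra.
From mathcomp Require Import complex ring lra zify.

Import Order.TTheory GRing.Theory Num.Theory.
Local Open Scope ring_scope.

(** * Spectral theory of real symmetric matrices shifted by a scalar *)

Section Spectral.
Variables (R : rcfType) (n : nat).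
Local Notation rc := (real_complex R).

(** A real symmetric matrix is Hermitian over [R[i]], hence diagonalizable with real eigenvalues;
    unique factorization of the characteristic polynomial identifies these with [spectrum A]. *)
Lemma sym_diagonalization (A : 'M[R]_n) : A^T = A ->
  exists (P : 'M[R[i]]_n) (d : 'rV[R]_n),
    [/\ P \in unitmx,
        map_mx rc A = invmx P *m map_mx rc (diag_mx d) *m P
      & perm_eq (spectrum A) [seq d 0 i | i <- enum 'I_n]].
Proof.
move=> symA; pose Ac := map_mx rc A.
have Ah : Ac \is hermsymmx.
  apply: realsym_hermsym.
    by apply/is_hermitianmxP; rewrite ?expr0 scale1r map_mx_id // map_trmx symA.
  by apply/mxOverP => i j; rewrite mxE complex_real.
have /mxOverP dR := hermitian_spectral_diag_real Ah.
have /orthomx_spectralP := hermitian_normalmx Ah.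
have : spectralmx Ac \in unitmx by exact: spectral_unit.
move: (spectralmx Ac) (spectral_diag Ac) dR => P d dR uP EA.
pose r : 'rV[R]_n := map_mx (@complex.Re R) d.
have Ed : d = map_mx rc r by apply/rowP => i; rewrite !mxE RRe_real.
have {}EA : map_mx rc A = invmx P *m map_mx rc (diag_mx r) *m P.
  by rewrite -/Ac {1}EA Ed map_diag_mx.
clearbody r; exists P, r; split=> //.
suff cE : char_poly A = \prod_(x <- [seq r 0 i | i <- enum 'I_n]) ('X - x%:P).
  by apply: prod_XsubC_eq; rewrite -cE -spectrum_prod.
rewrite big_map big_enum /=; apply: (@map_poly_inj _ _ rc).
have -> : \prod_i ('X - (r 0 i)%:P) = char_poly (diag_mx r).
  rewrite char_poly_trig ?diag_mx_is_trig //.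
  by apply: eq_bigr => i _; rewrite mxE eqxx mulr1n.
rewrite !map_char_poly EA /char_poly.
set D := map_mx rc _; pose Q := map_mx polyC P; pose Q' := map_mx polyC (invmx P).
have Q'Q : Q' *m Q = 1%:M by rewrite -map_mxM mulVmx // map_mx1.
have -> : char_poly_mx (invmx P *m D *m P) = Q' *m char_poly_mx D *m Q.
  rewrite /char_poly_mx mulmxBr mulmxBl scalar_mxC -(mulmxA _ Q' Q) Q'Q mulmx1.
  by rewrite !map_mxM.
by rewrite !det_mulmx mulrAC -det_mulmx Q'Q det1 mul1r.
Qed.

(** [Q] is conjugate to the diagonal matrix of the [p - mu], so [Q *m Q] is conjugate to that of
    their squares. Conjugation preserves the trace and fixes scalar matrices. *)
Lemma sym_shift_sqr (A : 'M[R]_n) (mu : R) : A^T = A ->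
  let Q := A - mu%:M in
  \tr (Q *m Q) = \sum_(p <- spectrum A) (p - mu) ^+ 2 /\
  forall s : R, Q *m Q = s%:M <-> {in spectrum A, forall p, (p - mu) ^+ 2 = s}.
Proof.
move=> /sym_diagonalization[P [d [uP EA pA]]] Q.
pose D := diag_mx (\row_i (d 0 i - mu) ^+ 2).
have EQ : map_mx rc (Q *m Q) = invmx P *m map_mx rc D *m P.
  have E1 : map_mx rc Q = invmx P *m map_mx rc (diag_mx d - mu%:M) *m P.
    rewrite /Q !map_mxB EA mulmxBr mulmxBl; congr (_ - _).
    by rewrite map_scalar_mx scalar_mxC -mulmxA mulVmx // mulmx1.
  rewrite map_mxM E1 !mulmxA mulmxK; last by [].
  rewrite -(mulmxA _ (map_mx rc _) (map_mx rc _)) -map_mxM.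
  congr (_ *m map_mx _ _ *m _); rewrite -diag_const_mx -linearB /= mulmx_diag.
  by congr diag_mx; apply/rowP => i; rewrite !mxE expr2.
split.
  apply: (fmorph_inj rc); rewrite -trace_map_mx EQ mxtrace_mulC mulmxA mulmxV //.
  rewrite mul1mx trace_map_mx mxtrace_diag (perm_big _ pA) big_map big_enum /=.
  by congr (rc _); apply: eq_bigr => i _; rewrite mxE.
move=> s; split=> [Es p|H].
  rewrite (perm_mem pA) => /mapP[i _ ->].
  have /matrixP/(_ i i) : map_mx rc D = map_mx rc s%:M.
    move: EQ; rewrite Es map_scalar_mx => E.
    have <- : P *m (invmx P *m map_mx rc D *m P) *m invmx P = map_mx rc D.
      by rewrite !mulmxA mulmxV // mul1mx mulmxK.
    by rewrite -E scalar_mxC mulmxK.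
  by rewrite !mxE eqxx !mulr1n => /fmorph_inj.
apply: (@map_mx_inj _ _ rc); rewrite EQ.
have -> : D = s%:M.
  rewrite -diag_const_mx; congr diag_mx; apply/rowP => i; rewrite !mxE.
  by apply: H; rewrite (perm_mem pA) map_f ?mem_enum.
by rewrite map_scalar_mx scalar_mxC mulmxKV.
Qed.

Lemma size_spectrum_sym (A : 'M[R]_n) : A^T = A -> size (spectrum A) = n.
Proof.
move=> /sym_diagonalization[P [d [_ _ /perm_size ->]]].
by rewrite size_map size_enum_ord.
Qed.

(* Cauchy-Schwarz, via [sum (|p - mu| - c)^2 = 2 c (n c - sum |p - mu|)]. *)
Lemma sym_shift_energy (A : 'M[R]_n) (mu : R) : A^T = A -> (0 < n)%N ->
  let Q := A - mu%:M in
  let s := \tr (Q *m Q) / n%:R in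
  let E := \sum_(p <- spectrum A) `|p - mu| in
  E <= n%:R * Num.sqrt s /\ (E = n%:R * Num.sqrt s <-> Q *m Q = s%:M).
Proof.
move=> symA n0 Q s E; have [trE sqrE] := sym_shift_sqr A mu symA.
have N0 : (0 : R) < n%:R by rewrite ltr0n.
have sN : s * n%:R = \sum_(p <- spectrum A) (p - mu) ^+ 2.
  by rewrite /s trE divfK // gt_eqF.
have s0 : 0 <= s.
  by rewrite /s trE divr_ge0 ?ler0n // sumr_ge0 // => p _; rewrite sqr_ge0.
set c := Num.sqrt s; have c0 : 0 <= c by exact: sqrtr_ge0.
have cc : c ^+ 2 = s by rewrite sqr_sqrtr.
have key : \sum_(p <- spectrum A) (`|p - mu| - c) ^+ 2 = 2%:R * c * (n%:R * c - E).
  under eq_bigr => p _ do rewrite sqrrB real_normK ?num_real //.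
  rewrite big_split sumrB /= -sN big_const_seq count_predT size_spectrum_sym //.
  rewrite iter_addr addr0 -[c ^+ 2 *+ n]mulr_natr sumrMnl -big_distrl /= -/E.
  by rewrite -mulr_natl cc -cc; ring.
have E0 (F : R -> R) : (forall p, 0 <= F p) -> \sum_(p <- spectrum A) F p = 0 ->
    {in spectrum A, forall p, F p = 0}.
  move=> F0 /eqP; rewrite psumr_eq0 // => /allP H p /H /implyP /(_ isT) /eqP //.
split.
  (* If [c = 0], [key] cannot be divided by [c]; but then the squares sum to zero, so every term of
     [E] vanishes. *)
  have := c0; rewrite le_eqVlt => /predU1P[c00|cp].
    rewrite /E big_seq big1 -?c00 ?mulr0 // => p pA; apply/eqP.
    rewrite normr_eq0 -sqrf_eq0; apply/eqP; move: p pA; apply: E0 => [p|].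
      exact: sqr_ge0.
    by rewrite -sN -cc -c00; ring.
  rewrite -subr_ge0 -(pmulr_rge0 _ (mulr_gt0 (ltr0Sn R 1) cp)) -key.
  by rewrite sumr_ge0 // => p _; rewrite sqr_ge0.
rewrite sqrE; split=> [EE p pA|H].
  (* Equality kills the right-hand side of [key], hence each square on its left. *)
  move: key; rewrite EE subrr mulr0 => /E0 /(_ p pA).
  move=> /(_ (fun=> sqr_ge0 _)) /eqP; rewrite sqrf_eq0 subr_eq0 => /eqP Ep.
  by rewrite -cc -Ep real_normK ?num_real.
rewrite /E big_seq (eq_bigr (fun=> c)) => [|p pA]; last first.
  by rewrite /c -(H p pA) sqrtr_sqr.
rewrite -big_seq big_const_seq count_predT size_spectrum_sym // iter_addr addr0.
by rewrite mulr_natl.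
Qed.

End Spectral.

(** * Degree counts, and graphs all of whose degrees are one *)

Section Degrees.
Variables (T : finType) (e : rel T).

(** Double counting of ordered adjacent pairs: the fibre over an edge with ends [a], [b] is [(a, b)]
    and [(b, a)], distinct because there are no loops. *)
Lemma handshake : symmetric e -> irreflexive e ->
  (\sum_x deg e x = 2 * gsize e)%N.
Proof.
move=> e_sym e_irr.
have -> : (\sum_x deg e x = \sum_(u : T * T | e u.1 u.2) 1)%N.
  under eq_bigr => x _ do rewrite /deg -sum1dep_card.
  by rewrite pair_big_dep.
rewrite (partition_big (fun u => [set u.1; u.2]) (mem (edges e))) /=; last first.
  by move=> u eu; apply/imsetP; exists u; rewrite ?inE.
rewrite /gsize -sum1_card big_distrr /=; apply: eq_bigr => E.
case/imsetP=> -[a b]; rewrite inE /= => eab ->.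
have ab : a != b by apply: contraTneq eab => ->; rewrite e_irr.
rewrite sum1dep_card.
suff -> : [set u : T * T | e u.1 u.2 & [set u.1; u.2] == [set a; b]]
    = [set (a, b); (b, a)].
  by rewrite cards2 xpair_eqE negb_and ab.
apply/setP => -[x y]; rewrite !inE !xpair_eqE /=; apply/idP/idP.
  case/andP=> exy /eqP/setP H.
  have xy : x != y by apply: contraTneq exy => ->; rewrite e_irr.
  have := H x; have := H y; rewrite !inE !eqxx orbT /=.
  case: (eqVneq x a) xy => [->|_] /= xy; last first.
    by case: (eqVneq x b) xy => // -> /=; rewrite eq_sym => /negPf -> /esym; rewrite orbF.
  by rewrite eq_sym (negPf xy) /= => /esym ->.
by case/orP=> /andP[/eqP -> /eqP ->]; rewrite ?eab ?(e_sym b a) ?eab ?eqxx // setUC eqxx.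
Qed.

End Degrees.

Lemma deg_giso (T1 T2 : finType) (e1 : rel T1) (e2 : rel T2) (f : T1 -> T2) :
  bijective f -> (forall x y, e2 (f x) (f y) = e1 x y) ->
  forall x, deg e1 x = deg e2 (f x).
Proof.
move=> bf fe x; rewrite /deg -(@on_card_preimset _ _ f) ; last first.
  exact: onW_bij.
by apply: eq_card => y; rewrite !inE fe.
Qed.

Lemma deg_complete_graph n (x : 'I_n) : deg (complete_graph n) x = n.-1.
Proof.
rewrite /deg -[in RHS](card_ord n) -(cardsC1 x); apply: eq_card => y.
by rewrite !inE eq_sym.
Qed.

Lemma deg_copies k (T : finType) (e : rel T) u : deg (copies k e) u = deg e u.2.
Proof.
rewrite /deg -[RHS](card_imset _ (_ : injective (pair u.1))) => [|x y []//].
apply: eq_card => -[i y]; rewrite !inE /=; apply/andP/imsetP => /= [[/eqP -> eu]|].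
  by exists y; rewrite ?inE.
by case=> z; rewrite inE => eu [-> ->].
Qed.

(** Sending a vertex to its only neighbour is a fixed-point-free involution. The copies are indexed
    by the smaller end of each pair, and the second coordinate tells the two ends apart. *)
Lemma perfect_matching_giso n (e : rel 'I_n) :
  symmetric e -> irreflexive e -> (forall x, deg e x = 1%N) ->
  giso e (copies n./2 (complete_graph 2)).
Proof.
move=> e_sym e_irr e_deg.
(* The default [x] is never taken, every vertex having a neighbour. *)
pose g x := odflt x [pick y | e x y].
have eg x y : e x y = (y == g x).
  have /eqP/cards1P[z /setP ez] := e_deg x.
  have {}ez y' : e x y' = (y' == z) by have := ez y'; rewrite !inE.
  rewrite /g; case: pickP => [t|/(_ z)] /=; rewrite ez ?eqxx //.
  by move=> /eqP ->; rewrite ez.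
have gK : involutive g by move=> x; apply/esym/eqP; rewrite -eg e_sym eg.
pose S := [set x : 'I_n | (x < g x)%N].
have gS x : (g x \in S) = (x \notin S).
  rewrite !inE gK -leqNgt [in RHS]leq_eqVlt.
  case: (@eqP _ (val (g x)) (val x)) => //= /val_inj gx.
  by have := eg x x; rewrite e_irr gx eqxx.
(* [g] exchanges [S] and its complement, so [S] is half of the vertices. *)
have cS : (#|S| = n./2).
  have E : ~: S = g @: S.
    apply/setP => x; rewrite inE -gS; apply/idP/imsetP => [gx|[y yS ->]].
      by exists (g x); rewrite ?gK.
    by rewrite gK.
  have := cardsC S; rewrite E card_imset ?card_ord; last exact: can_inj gK.
  by rewrite addnn => /(congr1 half); rewrite doubleK.
pose rep x := if x \in S then x else g x.
have repS x : rep x \in S by rewrite /rep; case: ifPn; rewrite // gS.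
have idx x : (index (rep x) (enum S) < n./2)%N.
  by rewrite -cS cardE index_mem mem_enum.
(* The position of the representative in [enum S] names the copy; membership in [S], read as 0 or 1,
   names the end. *)
pose f x : 'I_(n./2) * 'I_2 := (Ordinal (idx x), Ordinal (ltn_ord (inord (x \in S)))).
have f1 x y : ((f x).1 == (f y).1) = (rep x == rep y).
  rewrite -val_eqE /=; apply/eqP/eqP => [|-> //].
  by apply: (@index_inj _ (rep x)); rewrite ?inE ?mem_enum ?repS.
have f2 x y : ((f x).2 == (f y).2) = ((x \in S) == (y \in S)).
  by rewrite -val_eqE /= !inordK; case: (x \in S); case: (y \in S).
exists f => [|x y].
  apply: inj_card_bij => [x y fxy|].
    have := f1 x y; have := f2 x y; rewrite fxy !eqxx /rep => /esym/eqP -> /esym.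
    by case: ifP => _ /eqP // /(can_inj gK).
  by rewrite card_prod !card_ord -cS; have := max_card S; have := cardsC S; rewrite card_ord; lia.
rewrite /copies /complete_graph /= f1 f2 eg /rep.
case: (boolP (x \in S)) => xS; case: (boolP (y \in S)) => yS; rewrite /= ?andbT ?andbF.
- by apply/esym/negbTE; apply: contraTneq yS => ->; rewrite gS negbK.
- by rewrite -(inj_eq (can_inj gK)) gK eq_sym.
- by rewrite eq_sym.
- by apply/esym/negbTE; apply: contraNneq yS => ->; rewrite gS.
Qed.

(** * The square of the shifted [Aalpha], and what it says about degrees *)

Section Aalpha.
Variables (R : rcfType) (n : nat) (e : rel 'I_n).
Hypotheses (e_sym : symmetric e) (e_irr : irreflexive e).
Variable alpha : R.

Lemma Aalpha_sym : (Aalpha e alpha)^T = Aalpha e alpha.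
Proof.
rewrite /Aalpha linearD !linearZ /= /deg_mx tr_diag_mx; congr (_ + _ *: _).
by apply/matrixP => i j; rewrite !mxE e_sym.
Qed.

(** The entry at [x], [y] of the squared adjacency matrix, counting walks of length two. *)
Definition codeg (x y : 'I_n) : nat := #|[set z | e x z & e z y]|.

Lemma codegxx x : codeg x x = deg e x.
Proof. by apply: eq_card => z; rewrite !inE e_sym andbb. Qed.

(** [Q] is the diagonal matrix of the [u z] plus [1 - alpha] times the adjacency matrix; the three
    terms are the diagonal square, the two cross products and the adjacency square. *)
Lemma Aalpha_shift_sqrE (mu : R) x y :
  let Q := Aalpha e alpha - mu%:M in
  let u z := alpha * (deg e z)%:R - mu in
  (Q *m Q) x y = (u x ^+ 2) *+ (x == y)
    + (1 - alpha) * (u x + u y) * (e x y)%:R + (1 - alpha) ^+ 2 * (codeg x y)%:R.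
Proof.
move=> Q u; pose D : 'M[R]_n := diag_mx (\row_z u z); pose A := adj_mx R e.
have -> : Q = D + (1 - alpha) *: A.
  rewrite /Q /Aalpha addrAC; congr (_ + _).
  apply/matrixP => i j; rewrite !mxE /u.
  by case: eqP; rewrite ?mulr1n ?mulr0n // mulr0 subr0.
rewrite mulmxDl !mulmxDr -!scalemxAl -!scalemxAr scalerA.
rewrite mulmx_diag mul_diag_mx mul_mx_diag.
have AA : (A *m A) x y = (codeg x y)%:R.
  rewrite mxE /codeg -sum1dep_card natr_sum [RHS]big_mkcond; apply: eq_bigr => z _.
  by rewrite !mxE; case: (e x z); case: (e z y); rewrite ?mulr1 ?mulr0.
rewrite !mxE in AA *; rewrite AA.
by case: eqP => [->|_]; rewrite ?mulr1n ?mulr0n; ring.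
Qed.

Hypothesis n_gt0 : (0 < n)%N.
Let mu : R := 2%:R * alpha * (gsize e)%:R / n%:R.
Let Q := Aalpha e alpha - mu%:M.

Lemma sum_degR : \sum_x (deg e x)%:R = 2%:R * (gsize e)%:R :> R.
Proof. by rewrite -natr_sum handshake // natrM. Qed.

(** Each diagonal entry is a quadratic polynomial in the degree, so only [zagreb1] and the degree
    sum enter. The result is the [y] of the bound. *)
Lemma Aalpha_shift_trace :
  \tr (Q *m Q) = alpha ^+ 2 * (zagreb1 e)%:R
     + (1 - alpha) ^+ 2 * (2%:R * (gsize e)%:R)
     - 4%:R * alpha ^+ 2 * (gsize e)%:R ^+ 2 / n%:R.
Proof.
have N0 : n%:R != 0 :> R by rewrite pnatr_eq0 -lt0n.
rewrite /mxtrace (eq_bigr (fun x => alpha ^+ 2 * (deg e x ^ 2)%:R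
   + ((1 - alpha) ^+ 2 - 2%:R * alpha * mu) * (deg e x)%:R + mu ^+ 2)) => [|x _].
  rewrite !big_split /= -!big_distrr /= sum_degR -natr_sum sumr_const card_ord.
  by rewrite -[_ *+ n]mulr_natr /mu /zagreb1; field.
by rewrite Aalpha_shift_sqrE eqxx mulr1n e_irr mulr0 addr0 codegxx natrX; ring.
Qed.

Lemma Aalpha_shift_sqr_matching :
  (forall x, deg e x = 1%N) -> Q *m Q = ((1 - alpha) ^+ 2)%:M.
Proof.
move=> deg1; have N0 : n%:R != 0 :> R by rewrite pnatr_eq0 -lt0n.
have mu_alpha : mu = alpha.
  have := sum_degR; under eq_bigr => x _ do rewrite deg1.
  rewrite sumr_const card_ord => E.
  by rewrite /mu (mulrC 2%:R) -(mulrA alpha) -E mulfK.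
apply/matrixP => x y; rewrite Aalpha_shift_sqrE !deg1 mulr1 mu_alpha subrr.
rewrite expr0n /= mul0rn addr0 mulr0 mul0r !add0r mxE -[RHS]mulr_natr; congr (_ * _%:R).
case: eqP => [->|/eqP xy]; first by rewrite codegxx deg1.
(* A common neighbour [z] of distinct [x] and [y] would have degree at least two. *)
apply/eqP; rewrite cards_eq0; apply: contra_neqT xy => /set0Pn[z].
rewrite inE e_sym => /andP[ezx ezy].
have /eqP/cards1P[t /setP zt] := deg1 z.
by have := zt x; have := zt y; rewrite !inE ezx ezy => /esym/eqP -> /esym/eqP ->.
Qed.

Lemma matching_of_scalar_sqr (s : R) : 0 <= alpha -> alpha < 1 ->
  (0 < gsize e)%N -> Q *m Q = s%:M -> forall x, deg e x = 1%N.
Proof.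
move=> a0 a1 m0 /matrixP Es; set b := 1 - alpha; have b0 : 0 < b by rewrite subr_gt0.
have N0 : 0 < n%:R :> R by rewrite ltr0n.
pose u z := alpha * (deg e z)%:R - mu.
(* Off-diagonal entries of a scalar matrix vanish, and one factor [b > 0] cancels. *)
have off x y : x != y -> (u x + u y) * (e x y)%:R + b * (codeg x y)%:R = 0.
  move=> /negPf xy; have := Es x y; rewrite Aalpha_shift_sqrE mxE xy !mulr0n add0r.
  by rewrite -/b expr2 -!mulrA -mulrDr => /eqP; rewrite mulf_eq0 gt_eqF // => /eqP.
have clique x y z : x != y -> e x z -> e z y -> e x y.
  move=> xy exz ezy; apply: contraT => nexy; have := off x y xy.
  rewrite (negPf nexy) mulr0 add0r => /eqP.
  rewrite mulf_eq0 gt_eqF //= pnatr_eq0 cards_eq0 => /eqP/setP/(_ z).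
  by rewrite !inE exz ezy.
have [x0 [y0 exy0]] : exists x y, e x y.
  have /card_gt0P[E /imsetP[[x y]]] := m0.
  by rewrite inE /= => exy _; exists x, y.
case: (@arg_maxnP _ x0 xpredT (deg e) isT) => x _ xmax.
have dx0 : (0 < deg e x)%N.
  by apply: leq_trans (xmax x0 isT); apply/card_gt0P; exists y0; rewrite inE.
have [y] := card_gt0P dx0; rewrite inE => exy.
have xy : x != y by apply: contraTneq exy => ->; rewrite e_irr.
(* By [clique], every neighbour of [x] other than [y] is adjacent to [y]. *)
have Nx : [set z | e x z & e z y] = [set z | e x z] :\ y.
  apply/setP => z; rewrite !inE andbC; case: eqP => [->|/eqP zy]; first by rewrite e_irr.
  by case exz: (e x z); rewrite ?andbF ?andbT //= (clique z y x) // e_sym.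
have cxy : codeg x y = (deg e x).-1.
  by rewrite /codeg Nx /deg (cardsD1 y [set z | e x z]) inE exy.
(* The common neighbours of [x] and [y], together with [x], are [deg e x] neighbours of [y]. *)
have dxy : (deg e x <= deg e y)%N.
  rewrite /deg (cardsD1 y) (cardsD1 x [set z | e y z]) !inE exy e_sym exy leq_add2l.
  rewrite -Nx subset_leq_card //; apply/subsetP => z; rewrite !inE => /andP[exz ezy].
  by rewrite e_sym ezy andbT; apply: contraTneq exz => ->; rewrite e_irr.
have mu_avg : mu * n%:R = alpha * \sum_z (deg e z)%:R.
  by rewrite sum_degR /mu; field; rewrite gt_eqF.
have mu_le : mu <= alpha * (deg e x)%:R.
  rewrite -(ler_pM2r N0) mu_avg -mulrA ler_wpM2l // mulr_natr.
  have -> : (deg e x)%:R *+ n = \sum_(z < n) (deg e x)%:R :> R.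
    by rewrite sumr_const card_ord.
  by apply: ler_sum => z _; rewrite ler_nat; exact: xmax.
have uxy : u x + u y + b * (deg e x).-1%:R = 0.
  by have := off x y xy; rewrite exy mulr1 cxy.
(* [mu] is at most [alpha] times either degree, so [u x + u y] is nonnegative and [uxy] forces
   [(deg e x).-1] down to zero. *)
have dx1 : deg e x = 1%N.
  apply/eqP; rewrite eqn_leq dx0 andbT -subn_eq0 subn1 -(pnatr_eq0 R) eq_le ler0n andbT.
  rewrite -(pmulr_rle0 _ b0).
  have : alpha * (deg e x)%:R <= alpha * (deg e y)%:R by rewrite ler_wpM2l ?ler_nat.
  by move: uxy; rewrite /u; lra.
have d_le1 z : (deg e z <= 1)%N by rewrite -dx1; exact: xmax.
have dy1 : deg e y = 1%N by apply/eqP; rewrite eqn_leq d_le1 -dx1.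
have mu_alpha : mu = alpha.
  by move: uxy; rewrite /u dx1 dy1 mulr0; lra.
have diag z : (alpha * (deg e z)%:R - alpha) ^+ 2 + b ^+ 2 * (deg e z)%:R = s.
  have := Es z z; rewrite Aalpha_shift_sqrE mxE eqxx e_irr !mulr1n mulr0 addr0.
  by rewrite codegxx mu_alpha.
move=> z; apply/eqP; rewrite eqn_leq d_le1 lt0n; apply/negP => /eqP dz0.
(* The diagonal entry is [b ^+ 2] at [x] and [alpha ^+ 2] at the isolated [z]; as [b > 0], [alpha]
   cannot be zero. *)
have := diag x; rewrite -(diag z) dx1 dz0 => Eb.
have a_gt0 : 0 < alpha.
  rewrite lt_def a0 andbT; apply: contraTneq b0 => aE.
  by move: Eb; rewrite /b aE; lra.
(* Cancelling [alpha] in [mu = alpha] gives average degree one, whereas degrees at most one with [z]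
   isolated sum to less than [n]. *)
have : (\sum_t deg e t = n)%N.
  apply/eqP; rewrite -(eqr_nat R) natr_sum; apply/eqP.
  by apply: (mulfI (lt0r_neq0 a_gt0)); rewrite -mu_avg mu_alpha.
rewrite (bigD1 z) //= dz0 add0n => En.
have : (\sum_(t | t != z) deg e t <= \sum_(t | t != z) 1)%N by exact: leq_sum.
by rewrite En sum1_card cardC1 card_ord; lia.
Qed.

End Aalpha.

Theorem theorem4p8 (R : rcfType) (n : nat) (e : rel 'I_n)
    (e_sym : symmetric e) (e_irr : irreflexive e)
    (alpha : R) (alpha_ge0 : 0 <= alpha) (alpha_lt1 : alpha < 1) :
  let N : R := n%:R in
  let m : R := (gsize e)%:R in
  let M1 : R := (zagreb1 e)%:R in
  let y : R := alpha ^+ 2 * M1 + (1 - alpha) ^+ 2 * (2%:R * m)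
               - 4%:R * alpha ^+ 2 * m ^+ 2 / N in
  let B : R := Num.sqrt (y / N) + Num.sqrt ((N - 1) * (y - y / N)) in
  energy e alpha <= B /\
  ((0 < gsize e)%N ->
   (energy e alpha = B <->
    giso e (complete_graph 2) \/ giso e (copies n./2 (complete_graph 2)))).
Proof.
(* Order zero is separate, as [N] must be inverted: the spectrum is then empty and there is no
   edge. *)
move=> N m M1 y B; case: (posnP n) => [n0|n_gt0].
  have E0 (x : 'I_n) : False by case: x; rewrite n0.
  split; last by case/card_gt0P=> ? /imsetP[[x]]; case: (E0 x).
  have -> : energy e alpha = 0.
    rewrite /energy; have := size_spectrum_sym _ _ _ (Aalpha_sym R n e e_sym alpha).
    by rewrite [RHS]n0 => /size0nil ->; rewrite big_nil.
  by rewrite addr_ge0 ?sqrtr_ge0.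
have N0 : N != 0 by rewrite pnatr_eq0 -lt0n.
(* Since [y - y / N = (N - 1) * (y / N)], the two roots combine. *)
have BE : B = N * Num.sqrt (y / N).
  rewrite /B (_ : (N - 1) * (y - y / N) = (N - 1) ^+ 2 * (y / N)); last by field.
  by rewrite [Num.sqrt (_ ^+ 2 * _)]sqrtrM ?sqr_ge0 // sqrtr_sqr ger0_norm ?subr_ge0 ?ler1n //; ring.
have := sym_shift_energy _ _ _ (2%:R * alpha * m / N) (Aalpha_sym R n e e_sym alpha) n_gt0.
have yE := Aalpha_shift_trace R n e e_sym e_irr alpha n_gt0.
rewrite /= yE -BE => -[Ele Eeq]; split=> // m_gt0.
apply: (iff_trans Eeq); split=> [Es|iso_e].
  (* The second alternative covers the first: a single [K_2] is the case [n = 2]. *)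
  right; apply: perfect_matching_giso => //.
  exact: matching_of_scalar_sqr Es.
have deg1 x : deg e x = 1%N.
  case: iso_e => -[f bf fe]; rewrite (deg_giso _ _ _ _ _ bf fe) ?deg_copies;
  exact: deg_complete_graph.
have QQ := Aalpha_shift_sqr_matching R n e e_sym e_irr alpha n_gt0 deg1.
rewrite QQ; congr _%:M; rewrite -yE QQ mxtrace_scalar -[_ *+ n]mulr_natr.
by rewrite mulfK.
Qed.
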